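(* There exists an absolute constant $\gamma>0$ such that the following holds. Let $\mathfrak M=(\mathcal M,\rho)$ be a pseudometric space, and let $F$ be a set-valued mapping assigning to each $x\in\mathcal M$ a closed half-plane $F(x)\subset\mathbf R^2$. Assume that either $\mathcal M$ is finite or the half-planes $\{F(x):x\in\mathcal M\}$ are in general position, i.e., there exist $x_1,\dots,x_m\in\mathcal M$ such that the interior of the convex hull of $\mathbf n(x_1),\dots,\mathbf n(x_m)$ contains $0$, where $\mathbf n(x)$ is the (Euclidean) unit outward normal of $F(x)$. Then $F$ has a Lipschitz selection $f:\mathcal M\to\mathbf R^2$ if and only if there exists a constant $\lambda\ge0$ such that for every four elements $x,x',y,y'\in\mathcal M$ $$\operatorname{dist}(F(x)\cap F(x'),F(y)\cap F(y'))\le\lambda\,\mathfrak D[x,x';y,y'].$$ Furthermore, $\frac1{\sqrt2}\inf\lambda\le|F|_{\mathfrak M}\le\gamma\inf\lambda$, where the infimum is over all such $\lambda$.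
   Context: A pseudometric space $\mathfrak M=(\mathcal M,\rho)$ is a set with $\rho:\mathcal M\times\mathcal M\to[0,+\infty]$ such that $\rho(x,x)=0$, $\rho(x,y)=\rho(y,x)$, $\rho(x,y)\le\rho(x,z)+\rho(z,y)$; $\rho(x,y)=0$ with $x\ne y$ and $\rho(x,y)=+\infty$ are allowed. We read $\lambda\cdot(+\infty)=+\infty$ for every $\lambda\ge0$. $\mathbf R^2$ carries the uniform norm $\|x\|=\max\{|x_1|,|x_2|\}$, and $\operatorname{dist}(A,B)=\inf\{\|a-b\|:a\in A,b\in B\}$, with $\operatorname{dist}(\emptyset,A)=\operatorname{dist}(A,\emptyset)=0$ for every $A\subset\mathbf R^2$. For $f:\mathcal M\to\mathbf R^2$, $\|f\|_{\mathrm{Lip}(\mathcal M)}=\inf\{\lambda\ge0:\|f(x)-f(y)\|\le\lambda\rho(x,y)\ \forall x,y\in\mathcal M\}$ ($\inf\emptyset=+\infty$); $f$ is Lipschitz if this is finite. A selection of $F$ is a map $f:\mathcal M\to\mathbf R^2$ with $f(x)\in F(x)$ for all $x$. $|F|_{\mathfrak M}$ is the infimum of $\|f\|_{\mathrm{Lip}(\mathcal M)}$ over all Lipschitz selections $f$ of $F$, and $+\infty$ if there are none. $\varphi_F(x,y)\in[0,\pi/2]$ denotes the angle between the boundary lines of $F(x)$ and $F(y)$ ($0$ if parallel). $\operatorname{diam}_\rho$ denotes the diameter with respect to $\rho$. With the conventions $0/0=0$ and $a/0=+\infty$ for $a>0$, $$\mathfrak D[x,x';y,y']=\frac{\rho(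x,x')}{\sin\varphi_F(x,x')}+\frac{\rho(y,y')}{\sin\varphi_F(y,y')}+\operatorname{diam}_\rho\{x,x',y,y'\}.$$
   Formalization: In the general-position case it is also assumed that each set of points at finite distance from a given point is finite or carries half-planes in general position; this is automatic when ρ is finite-valued, and without it the claim fails when ρ=+∞ is allowed. *)

(* Defs.v *)
From mathcomp Require Import all_boot all_order all_algebra.
From mathcomp Require Import all_classical all_reals all_analysis.

Set Implicit Arguments.
Unset Strict Implicit.
Unset Printing Implicit Defensive.

Import Order.TTheory GRing.Theory Num.Theory.
Import numFieldNormedType.Exports.

Local Open Scope classical_set_scope.
Local Open Scope ring_scope.

(* The library norm of a pair is the uniform norm max(`|u.1|, `|u.2|). *)
Notation plane R := (R * R)%type (only parsing).

Section Plane.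
Variable R : realType.

Definition dotp (u v : plane R) : R := u.1 * v.1 + u.2 * v.2.

(* A closed half-plane is {u | <n, u> <= c} for a unique pair (n, c) with n a
   Euclidean unit vector, and n is then its outward normal. *)
Record half_plane := HalfPlane {
  normal : plane R;
  offset : R;
  normal_unit : dotp normal normal = 1
}.

Definition hp_set (H : half_plane) : set (plane R) :=
  [set u | dotp (normal H) u <= offset H].

Definition line_dir (H : half_plane) : plane R :=
  (- (normal H).2, (normal H).1).

(* The angle in [0, pi/2] between the boundary lines of H and K. *)
Definition angle (H K : half_plane) : R :=
  acos `|dotp (line_dir H) (line_dir K)|.

Definition dist (A B : set (plane R)) : \bar R :=
  if `[< A = set0 \/ B = set0 >] then 0%E
  else ereal_inf [set (`|a - b|)%:E | a in A & b in B].

Definition conv_hull (m : nat) (p : 'I_m -> plane R) : set (plane R) :=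
  [set v | exists t : 'I_m -> R,
     [/\ forall i, 0 <= t i, \sum_(i < m) t i = 1
       & v = \sum_(i < m) t i *: p i]].

(* lambda * t with lambda * +oo = +oo for every lambda >= 0; the library's
   product has 0 * +oo = 0. *)
Definition scale (lambda : R) (t : \bar R) : \bar R :=
  if t == +oo%E then +oo%E else (lambda%:E * t)%E.

End Plane.

Section Selections.
Variables (R : realType) (M : Type) (rho : M -> M -> \bar R).

Definition pseudometric : Prop :=
  [/\ forall x y, (0 <= rho x y)%E,
      forall x, rho x x = 0%E,
      forall x y, rho x y = rho y x
    & forall x y z, (rho x y <= rho x z + rho z y)%E].

Definition diam (A : set M) : \bar R :=
  ereal_sup [set rho u v | u in A & v in A].

Definition lip_bound (f : M -> plane R) (lambda : R) : Prop :=
  0 <= lambda /\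
  forall x y, ((`|f x - f y|)%:E <= scale lambda (rho x y))%E.

Definition lip_norm (f : M -> plane R) : \bar R :=
  ereal_inf [set lambda%:E | lambda in [set l | lip_bound f l]].

Definition is_lipschitz (f : M -> plane R) : Prop := (lip_norm f < +oo)%E.

Variable F : M -> half_plane R.

Definition selection (f : M -> plane R) : Prop :=
  forall x, hp_set (F x) (f x).

(* |F|_M *)
Definition lip_selection_norm : \bar R :=
  ereal_inf [set lip_norm f | f in [set f | is_lipschitz f /\ selection f]].

(* The library's division has 0 / 0 = 0 and a / 0 = +oo for a > 0. *)
Definition frakD (x x' y y' : M) : \bar R :=
  (rho x x' / (sin (angle (F x) (F x')))%:E
   + rho y y' / (sin (angle (F y) (F y')))%:E
   + diam [set x; x'; y; y'])%E.

Definition dist_bound (lambda : R) : Prop :=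
  0 <= lambda /\
  forall x x' y y' : M,
    (dist (hp_set (F x) `&` hp_set (F x')) (hp_set (F y) `&` hp_set (F y'))
     <= scale lambda (frakD x x' y y'))%E.

Definition inf_dist_bound : \bar R :=
  ereal_inf [set lambda%:E | lambda in [set l | dist_bound l]].

Definition general_position (S : set M) : Prop :=
  exists (m : nat) (x : 'I_m -> M),
    (forall i, S (x i)) /\
    interior (conv_hull (fun i => normal (F (x i)))) 0.

Definition component (z : M) : set M := [set x | (rho z x < +oo)%E].

(* Automatic from general_position setT when rho is finite-valued (there is
   then a single component). Without it the selection criterion fails: take
   the half-planes [set u | k%:R <= u.1], k : nat, at mutual distance 1,
   together with finitely many points at distance +oo from them carrying
   half-planes in general position. *)
Definition finite_or_gp_components : Prop :=
  forall z, finite_set (component z) \/ general_position (component z).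

End Selections.

(* Main.v *)
Require Import Defs.
From mathcomp Require Import all_boot all_order all_algebra.
From mathcomp Require Import all_classical all_reals all_analysis.
From mathcomp Require Import ring lra.
Import Order.TTheory GRing.Theory Num.Theory.
Import numFieldNormedType.Exports.
Local Open Scope classical_set_scope.
Local Open Scope ring_scope.

(** Necessity is elementary ([lipschitz_selection_dist_bound]). Sliding [f x]
    along the boundary direction of [F x] reaches [F x'] after a length of at
    most [sqrt 2 * `|f x - f x'| / sin phi], so [f x] lies close to
    [F x /\ F x'], and [f y] to [F y /\ F y'].

    For sufficiency, points at infinite distance do not constrain each other, so
    it is enough to work inside one component, where the distance [d] is finite;
    the half-plane of [z] is written [n_z . u <= c_z]. A finiteness principle
    then reduces the problem to finding Lipschitz selections, with a uniform
    constant, on quadruples of points.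

    For four points [four_point_selection] uses coordinates [(a, b)] adapted to
    the four half-planes, in which no boundary line is close to vertical
    ([exists_transversal]). Each half-plane then bounds [b] from below or from
    above by an affine function of [a] of bounded slope. Once [a] is Lipschitz,
    a Lipschitz [b] exists as soon as lower bounds stay below upper bounds up to
    a multiple of the distance. For a pair of half-planes this is a one-sided
    bound on [a] alone, at the abscissa of the corner of the pair, relaxed by
    distance over difference of slopes. Two such bounds are compatible because the corner of one pair is within [lambda * D] of that of the other,
    the difference of slopes being comparable with the sine of the angle.

    For the principle itself put [G x], the set of all [u] with
    [n_z . u <= c_z + K d(x, z)] for every [z]. A Lipschitz map whose value at
    [z] lies in [F z] satisfies the constraint of [z] at every [x], if [K] is
    large enough. Eliminating the second coordinate turns the projection of [G x]
    to the first axis into an intersection of half-lines, each coming from two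
    constraints, hence two half-lines from four points, and four-point
    selections make them compatible. This gives Lipschitz [g1], [g2] with
    [g1 x] and [g2 x] in the two projections of [G x]
    ([coordinate_selection]). The point [g x = (g1 x, g2 x)] can lie outside
    [G x], but the normals of all constraints that it violates then lie in one
    open quadrant. A shift along the diagonal of that quadrant, by the largest
    violation divided by the l1-norm of the normal, puts it into [G x], and the
    length of the shift is Lipschitz, as a supremum of Lipschitz functions
    ([correct_violations]). As [d(x, x) = 0], [G x] is contained in [F x]. *)

Section HalfPlanes.
Context {R : realType}.

(** * Lipschitz functions between prescribed bounds *)

Definition real_pseudometric {X : Type} (d : X -> X -> R) : Prop :=
  [/\ forall x y, 0 <= d x y, forall x, d x x = 0,
      forall x y, d x y = d y x & forall x y z, d x z <= d x y + d y z].

(** One inequality suffices: the other one follows by exchanging [x] and [y]. *)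
Definition real_lipschitz {X : Type} (d : X -> X -> R) (L : R) (a : X -> R) :=
  forall x y, a x - a y <= L * d x y.

Lemma real_lipschitz_norm {X : Type} (d : X -> X -> R) (L : R) (a : X -> R) x y :
  real_pseudometric d -> real_lipschitz d L a -> `|a x - a y| <= L * d x y.
Proof. by move=> [_ _ dC _] aL; rewrite ler_norml aL lerNl opprB dC aL. Qed.

Lemma real_lipschitz_mul {X : Type} (d : X -> X -> R) (L : R) (a : X -> R) r x y :
  real_pseudometric d -> real_lipschitz d L a -> `|r| <= 1 ->
  r * (a x - a y) <= L * d x y.
Proof.
move=> dP aL r1; apply: le_trans (ler_norm _) _; rewrite normrM.
have := real_lipschitz_norm d L a x y dP aL.
by move/(ler_pM (normr_ge0 r) (normr_ge0 _) r1); rewrite mul1r.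
Qed.

(** The only consequence of finiteness that the argument uses: families of real
    bounds indexed by a finite set have a finite supremum. *)
Definition all_bounded (T : Type) : Prop :=
  forall phi : T -> R, exists N, forall t, `|phi t| <= N.

Lemma all_bounded_prod {S T : Type} :
  all_bounded S -> all_bounded T -> all_bounded (S * T).
Proof.
move=> bS bT phi.
have /choice[N HN] : forall s, exists N, forall t, `|phi (s, t)| <= N.
  by move=> s; apply: (bT (fun t => phi (s, t))).
have [N' HN'] := bS N; exists N' => -[s t].
by apply: le_trans (HN s t) _; apply: le_trans (ler_norm _) (HN' s).
Qed.

Lemma all_bounded_fin (T : finType) : all_bounded T.
Proof.
move=> phi; exists (\sum_t `|phi t|) => t.
by rewrite (bigD1 t) //= lerDl sumr_ge0.
Qed.

(** The least function above the lower bounds with constant [L], that is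
    [x |-> sup (l - L * d x y)], works whenever both kinds of bounds occur,
    since each upper bound then makes the supremum finite. If one kind is
    absent, a constant function works provided that the other kind is
    bounded. *)
Lemma lipschitz_between {X : Type} (d : X -> X -> R) (L : R)
    (Lo Up : X -> set R) :
  real_pseudometric d -> 0 <= L ->
  (forall x y l u, Lo x l -> Up y u -> l <= u + L * d x y) ->
  ((exists x l, Lo x l) /\ (exists y u, Up y u)) \/
    (exists N, forall x l, Lo x l \/ Up x l -> `|l| <= N) ->
  exists a, real_lipschitz d L a /\
    forall x, (forall l, Lo x l -> l <= a x) /\ (forall u, Up x u -> a x <= u).
Proof.
move=> [d0 dxx dC dT] L0 LU tame.
have const N : (forall x l, Lo x l -> l <= N) -> (forall x l, Up x l -> N <= l) ->
    exists a, real_lipschitz d L a /\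
    forall x, (forall l, Lo x l -> l <= a x) /\ (forall u, Up x u -> a x <= u).
  move=> HL HU; exists (fun=> N); split=> [x y|x]; first by rewrite subrr mulr_ge0.
  by split; [apply: HL | apply: HU].
have [neL|] := pselect (exists x l, Lo x l); last first.
  move=> noL; case: tame => [[]//|[N HN]]; apply: (const (- N)) => x l xl.
    by case: noL; exists x, l.
  by have := HN x l (or_intror xl); rewrite ler_norml => /andP[].
have [neU|] := pselect (exists x u, Up x u); last first.
  move=> noU; case: tame => [[]//|[N HN]]; apply: (const N) => x l xl.
    by have := HN x l (or_introl xl); rewrite ler_norml => /andP[].
  by case: noU; exists x, l.
pose S x : set R := [set v | exists y l, Lo y l /\ v = l - L * d x y].
have ubS x u : Up x u -> ubound (S x) u.
  move=> xu _ [y [l [yl ->]]]; rewrite lerBlDr dC; exact: LU.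
have neS x : S x !=set0.
  by have [y [l yl]] := neL; exists (l - L * d x y), y, l.
have hsS x : has_sup (S x).
  split; first exact: neS.
  have [y [u yu]] := neU; exists (u + L * d x y) => _ [y' [l [yl ->]]].
  have := LU _ _ _ _ yl yu.
  have : L * d y' y <= L * (d y' x + d x y) by rewrite ler_wpM2l.
  by rewrite (dC x y'); lra.
exists (fun x => sup (S x)); split=> [x y|x].
  rewrite lerBlDr; apply: ge_sup => // _ [y' [l [yl ->]]].
  have : l - L * d y y' <= sup (S y) by apply: sup_upper_bound => //; exists y', l.
  have : L * d y y' <= L * (d y x + d x y') by rewrite ler_wpM2l.
  by rewrite (dC y x); lra.
split=> [l xl|u xu].
  apply: sup_upper_bound => //; exists x, l; split=> //.
  by rewrite dxx mulr0 subr0.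
by apply: ge_sup => //; apply: ubS.
Qed.

(** * Eliminating one coordinate *)

(** Nonnegative weights for combining two constraints with coefficients
    [q <= 0 <= q'] so that the variable cancels. The indicator terms let a
    constraint that does not contain the variable survive the combination:
    with [q = q' = 0] both weights are [1], where [q'] and [- q] alone would
    give the void constraint. *)
Definition elim_left (q q' : R) := q' + (q == 0)%:R.
Definition elim_right (q q' : R) := - q + (q' == 0)%:R.

Lemma elim_left_ge0 q q' : 0 <= q' -> 0 <= elim_left q q'.
Proof. by move=> ?; rewrite addr_ge0 // ler0n. Qed.
Lemma elim_right_ge0 q q' : q <= 0 -> 0 <= elim_right q q'.
Proof. by move=> ?; rewrite addr_ge0 ?ler0n // oppr_ge0. Qed.
Lemma elim_balance q q' : elim_left q q' * q + elim_right q q' * q' = 0.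
Proof.
rewrite /elim_left /elim_right.
case: (eqVneq q 0) => [->|_]; case: (eqVneq q' 0) => [->|_] /=; ring.
Qed.

(** Every constraint is a half-line, so consistency is pairwise; this is
    [lipschitz_between] over a single point. *)
Lemma fourier_motzkin {I : Type} (q b : I -> R) :
  all_bounded I \/ ((exists i, q i < 0) /\ (exists j, 0 < q j)) ->
  (forall i j, q i <= 0 -> 0 <= q j ->
     0 <= elim_left (q i) (q j) * b i + elim_right (q i) (q j) * b j) ->
  exists t, forall i, q i * t <= b i.
Proof.
move=> tame elim.
pose Lo (_ : unit) : set R := [set v | exists i, q i < 0 /\ v = b i / q i].
pose Up (_ : unit) : set R := [set v | exists i, 0 < q i /\ v = b i / q i].
case: (lipschitz_between (X := unit) (fun _ _ => 0) 0 Lo Up).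
- by split=> // *; rewrite addr0.
- by [].
- move=> _ _ _ _ [i [qi ->]] [j [qj ->]]; rewrite mul0r addr0.
  have := elim i j (ltW qi) (ltW qj).
  rewrite /elim_left /elim_right (lt_eqF qi) (gt_eqF qj) !addr0 => h.
  rewrite ler_pdivlMr // mulrAC ler_ndivrMr //; lra.
- case: tame => [bI|[[i qi] [j qj]]].
    right; have [N HN] := bI (fun i => b i / q i); exists N.
    by move=> u l [] [i [_ ->]]; apply: HN.
  by left; split; exists tt; [exists (b i / q i), i | exists (b j / q j), j].
move=> a [_ /(_ tt)[aL aU]]; exists (a tt) => i.
have [qi|qi|qi0] := ltgtP (q i) 0.
- by rewrite mulrC -ler_ndivrMr //; apply: aL; exists i.
- by rewrite mulrC -ler_pdivlMr //; apply: aU; exists i.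
- have := elim i i; rewrite qi0 => /(_ (lexx _) (lexx _)).
  rewrite /elim_left /elim_right eqxx /=; lra.
Qed.

(** The vectors [(p j, q j)] meet every open half-plane bounded by a line through
    the origin. This is the form in which general position is used: it makes
    upper and lower bounds occur on each coordinate. *)
Definition spanning {J : Type} (p q : J -> R) : Prop :=
  forall a b : R, a != 0 \/ b != 0 -> exists j, 0 < p j * a + q j * b.

(** If no combination of two constraints bounded the first coordinate from above,
    elimination would give a [t] with [p i + q i * t <= 0] for all [i], so that
    no vector would be positive on the direction [(1, t)]. *)
Lemma spanning_pair {J : Type} (p q : J -> R) : spanning p q ->
  exists i j, [/\ q i <= 0, 0 <= q j &
    0 < elim_left (q i) (q j) * p i + elim_right (q i) (q j) * p j].
Proof.
move=> span; apply: contrapT => none.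
have N1_neq0 : (-1 : R) != 0 by rewrite oppr_eq0 oner_eq0.
have [i qi] := span 0 (-1) (or_intror N1_neq0).
have [j qj] := span 0 1 (or_intror (oner_neq0 R)).
case: (fourier_motzkin q (fun i => - p i)).
- by right; split; [exists i; lra | exists j; lra].
- move=> i' j' qi' qj'; rewrite leNgt; apply/negP => lt0; apply: none.
  by exists i', j'; split=> //; lra.
- move=> t ht; have [k pk] := span 1 t (or_introl (oner_neq0 R)).
  by have := ht k; lra.
Qed.

(** The values allowed for the first coordinate at [x] are cut out by pairs of
    constraints, one with [q <= 0] and one with [0 <= q]. Comparing two
    such pairs involves four constraints, for which the hypothesis provides a
    simultaneous Lipschitz solution; compatibility of the resulting bounds with
    [lipschitz_between] is read off from that solution. *)
Lemma coordinate_selection {X J : Type} (d : X -> X -> R) (C : R)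
    (p q : J -> R) (b : J -> X -> R) :
  real_pseudometric d -> 0 <= C ->
  (all_bounded J /\ all_bounded X) \/ spanning p q ->
  (forall k : bool -> bool -> J, exists u v : X -> R, real_lipschitz d C u /\
     forall s t x, p (k s t) * u x + q (k s t) * v x <= b (k s t) x) ->
  exists g, real_lipschitz d C g /\
    forall x, exists t, forall j, p j * g x + q j * t <= b j x.
Proof.
move=> dP C0 tame four; have [d0 dxx dC dT] := dP.
have [[x0 _]|noX] := pselect (exists x : X, True); last first.
  by exists (fun=> 0); split=> [x|x]; case: noX; exists x.
pose al i j := elim_left (q i) (q j) * p i + elim_right (q i) (q j) * p j.
pose be i j x := elim_left (q i) (q j) * b i x + elim_right (q i) (q j) * b j x.
have combine i j x u v : q i <= 0 -> 0 <= q j ->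
    p i * u + q i * v <= b i x -> p j * u + q j * v <= b j x ->
    al i j * u <= be i j x.
  move=> qi qj /(ler_wpM2l (elim_left_ge0 (q i) _ qj)) hi
    /(ler_wpM2l (elim_right_ge0 _ (q j) qi)) hj.
  have := elim_balance (q i) (q j); rewrite /al /be => bal.
  have -> : (elim_left (q i) (q j) * p i + elim_right (q i) (q j) * p j) * u =
    elim_left (q i) (q j) * (p i * u + q i * v) + elim_right (q i) (q j) * (p j * u + q j * v)
    - (elim_left (q i) (q j) * q i + elim_right (q i) (q j) * q j) * v by ring.
  by rewrite bal mul0r subr0 lerD.
pose Lo x : set R := [set v | exists i j, [/\ q i <= 0, 0 <= q j,
  al i j < 0 & v = be i j x / al i j]].
pose Up x : set R := [set v | exists i j, [/\ q i <= 0, 0 <= q j,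
  0 < al i j & v = be i j x / al i j]].
case: (lipschitz_between d C Lo Up dP C0).
- move=> x y _ _ [i [j [qi qj al0 ->]]] [i' [j' [qi' qj' al0' ->]]].
  have [u [v [uL uv]]] := four (fun s t => if s then (if t then i else j)
    else (if t then i' else j')).
  have hx : al i j * u x <= be i j x.
    by apply: (combine _ _ _ _ (v x)) => //;
      [apply: (uv true true) | apply: (uv true false)].
  have hy : al i' j' * u y <= be i' j' y.
    by apply: (combine _ _ _ _ (v y)) => //;
      [apply: (uv false true) | apply: (uv false false)].
  have : be i j x / al i j <= u x by rewrite ler_ndivrMr // mulrC.
  have : u y <= be i' j' y / al i' j' by rewrite ler_pdivlMr // mulrC.
  by have := uL x y; lra.
- case: tame => [[bJ bX]|span].
    right; have [N HN] := all_bounded_prod (all_bounded_prod bJ bJ) bX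
      (fun t => be t.1.1 t.1.2 t.2 / al t.1.1 t.1.2).
    by exists N => x l [] [i [j [_ _ _ ->]]]; apply: (HN (i, j, x)).
  have spanN : spanning (fun j => - p j) q.
    move=> a c ac; have [|j hj] := span (- a) c; first by rewrite oppr_eq0.
    by exists j; lra.
  have [i [j [qi qj hp]]] := spanning_pair p q span.
  have [i' [j' [qi' qj' hn]]] := spanning_pair _ q spanN.
  left; split; exists x0.
    exists (be i' j' x0 / al i' j'), i', j'; split=> //.
    by rewrite /al; lra.
  by exists (be i j x0 / al i j), i, j.
move=> g [gL gLU]; exists g; split=> // x; have [gLo gUp] := gLU x.
have [||t ht] := fourier_motzkin q (fun j => b j x - p j * g x).
- case: tame => [[bJ _]|span]; [by left | right].
  have N1_neq0 : (-1 : R) != 0 by rewrite oppr_eq0 oner_eq0.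
  have [i qi] := span 0 (-1) (or_intror N1_neq0).
  have [j qj] := span 0 1 (or_intror (oner_neq0 R)).
  by split; [exists i; lra | exists j; lra].
- move=> i j qi qj.
  suff : al i j * g x <= be i j x by rewrite /al /be; lra.
  have [al0|al0|al0] := ltgtP (al i j) 0.
  + by rewrite mulrC -ler_ndivrMr //; apply: gLo; exists i, j.
  + by rewrite mulrC -ler_pdivlMr //; apply: gUp; exists i, j.
  + have [u [v [_ uv]]] := four (fun s _ => if s then i else j).
    have := combine i j x (u x) (v x) qi qj (uv true true x) (uv false true x).
    by rewrite al0 !mul0r.
by exists t => j; have := ht j; lra.
Qed.

(** * Moving a point into all half-planes along a diagonal *)

Lemma sup_lipschitz {X J : Type} (d : X -> X -> R) (L : R) (h : J -> X -> R)
    (P : set J) : (forall j, P j -> real_lipschitz d L (h j)) -> P !=set0 ->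
  (forall x, exists N, forall j, P j -> h j x <= N) ->
  real_lipschitz d L (fun x => sup [set h j x | j in P]).
Proof.
move=> hL [j0 Pj0] hB x y; rewrite lerBlDr.
apply: ge_sup; first by exists (h j0 x), j0.
move=> _ [j Pj <-].
have : h j y <= sup [set h i y | i in P].
  apply: sup_upper_bound; last by exists j.
  split; first by exists (h j0 y), j0.
  by have [N HN] := hB y; exists N => _ [i Pi <-]; apply: HN.
by have := hL j Pj x y; lra.
Qed.

(** Here [e] is the excess of a constraint with normal [(p, q)] at a point [g], and
    the constraint holds at [g + (S, 0)] and at [g + (0, T)]. The diagonal from
    [g] meets the segment between these two points at [g + (r, r)] with
    [r = S * T / (S + T)], where the constraint holds by convexity; the excess
    is therefore used up by then. *)
Lemma excess_le_harmonic (p q e S T : R) : 0 < S -> 0 < T -> p < 0 -> q < 0 ->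
  e + p * S <= 0 -> e + q * T <= 0 -> e / (- p - q) <= S * T / (S + T).
Proof.
move=> S0 T0 p0 q0 hS hT.
have ST : 0 < S + T by lra.
have pq : 0 < - p - q by lra.
rewrite ler_pdivrMr // [leRHS]mulrAC ler_pdivlMr //.
by have := ler_wpM2l (ltW T0) hS; have := ler_wpM2l (ltW S0) hT; lra.
Qed.

(** A shift by [(r, r)] that does not leave the triangle [g], [g + (S, 0)],
    [g + (0, T)] cannot create a new violation: a constraint that gets worse along
    the diagonal has [0 < p + q], and it still holds at the exit point on the
    opposite side, which is a convex combination of the two far vertices. *)
Lemma diagonal_shift (p q e S T r : R) : 0 < S -> 0 < T ->
  0 <= r -> r <= S * T / (S + T) ->
  e + p * S <= 0 -> e + q * T <= 0 -> (p < 0 -> q < 0 -> e <= r * (- p - q)) ->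
  e + (p + q) * r <= 0.
Proof.
move=> S0 T0 r0 rle hS hT hpq.
have [pq|pq] := lerP (p + q) 0.
  have [p0|p0] := ltP p 0; have [q0|q0] := ltP q 0; first by have := hpq p0 q0; lra.
  - have qT : 0 <= q * T by rewrite mulr_ge0 // ltW.
    have : (p + q) * r <= 0 by rewrite mulr_le0_ge0.
    lra.
  - have pS : 0 <= p * S by rewrite mulr_ge0 // ltW.
    have : (p + q) * r <= 0 by rewrite mulr_le0_ge0.
    lra.
  - have pS : 0 <= p * S by rewrite mulr_ge0 // ltW.
    have : (p + q) * r <= 0 by rewrite mulr_le0_ge0.
    lra.
have ST : 0 < S + T by lra.
(* the exit point is the mean of the far vertices with weights T and S *)
apply: (@le_trans _ _ (e + (p + q) * (S * T / (S + T)))).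
  by rewrite lerD2l ler_wpM2l // ltW.
have -> : e + (p + q) * (S * T / (S + T)) =
    (T * (e + p * S) + S * (e + q * T)) / (S + T).
  by field; rewrite gt_eqF.
rewrite ler_pdivrMr // mul0r.
have := ler_wpM2l (ltW T0) hS; have := ler_wpM2l (ltW S0) hT; lra.
Qed.

Definition sgn_of (s : bool) : R := (-1) ^+ s.

Lemma sgn_of_abs s : `|sgn_of s| = 1. Proof. by rewrite normr_sign. Qed.
Lemma sgn_of_sqr s : sgn_of s * sgn_of s = 1. Proof. by rewrite -expr2 sqrr_sign. Qed.
Lemma sgn_of_lt0 (a : R) : a != 0 -> sgn_of (a < 0) * a = `|a|.
Proof.
move=> a0; rewrite [in RHS](numEsign a) normrM normr_id normr_sign mul1r /sgn_of.
by rewrite {2}(numEsign a) mulrA -expr2 sqrr_sign mul1r.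
Qed.

Lemma sgn_of_gt0 m (a : R) : 0 < sgn_of m * a -> m = (a < 0).
Proof.
rewrite /sgn_of; case: m; rewrite ?expr1 ?expr0 ?mulN1r ?mul1r => h; first by rewrite -oppr_gt0 h.
by rewrite ltNge (ltW h).
Qed.

(** If [(g1 x, t)] and [(s, g2 x)] satisfy all constraints at [x], then a constraint
    violated at [(g1 x, g2 x)] has [0 < p j * (g1 x - s)] and
    [0 < q j * (g2 x - t)], so the signs of [p j] and [q j] are those of
    [g1 x - s] and [g2 x - t]. Hence at most one of the four shift lengths below,
    one for each quadrant, is nonzero at [x]. Subtracting all four signed shifts
    gives a formula independent of [x], which is what makes the result
    Lipschitz. *)
Lemma correct_violations {X J : Type} (d : X -> X -> R) (C K : R)
    (p q : J -> R) (b : J -> X -> R) (g1 g2 : X -> R) :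
  real_pseudometric d -> 0 <= C -> 0 <= K ->
  (forall j, 1 <= `|p j| + `|q j|) ->
  (forall j, real_lipschitz d K (b j)) ->
  real_lipschitz d C g1 -> real_lipschitz d C g2 ->
  (forall x, exists t, forall j, p j * g1 x + q j * t <= b j x) ->
  (forall x, exists s, forall j, p j * s + q j * g2 x <= b j x) ->
  exists f1 f2, [/\ real_lipschitz d (5 * C + 4 * K) f1,
    real_lipschitz d (5 * C + 4 * K) f2 &
    forall x j, p j * f1 x + q j * f2 x <= b j x].
Proof.
move=> [d0 dxx dC dT] C0 K0 pq1 bL g1L g2L ex_t ex_s.
have pq0 j : 0 < `|p j| + `|q j| by apply: lt_le_trans (pq1 j).
pose e j x := p j * g1 x + q j * g2 x - b j x.
pose h (oj : option J) x :=
  if oj is Some j then e j x / (`|p j| + `|q j|) else 0.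
(* None contributes the value 0, so that the suprema are nonnegative *)
pose P (k : bool * bool) : set (option J) := [set oj | if oj is Some j
  then 0 < sgn_of k.1 * p j /\ 0 < sgn_of k.2 * q j else True].
pose r k x := sup [set h oj x | oj in P k].
have eT j x t : p j * g1 x + q j * t <= b j x -> e j x <= q j * (g2 x - t).
  by rewrite /e; lra.
have eS j x s : p j * s + q j * g2 x <= b j x -> e j x <= p j * (g1 x - s).
  by rewrite /e; lra.
have hB k x : exists N, forall oj, P k oj -> h oj x <= N.
  have [t ht] := ex_t x; exists `|g2 x - t| => -[j|] _ //=.
  rewrite ler_pdivrMr //; apply: le_trans (eT _ _ _ (ht j)) _.
  apply: le_trans (ler_norm _) _; rewrite normrM mulrC ler_wpM2l //.
  by rewrite lerDr.
have PN k : P k None by [].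
have r_ub k x j : P k (Some j) -> e j x <= r k x * (`|p j| + `|q j|).
  move=> Pj; rewrite -ler_pdivrMr //; apply: sup_upper_bound; last by exists (Some j).
  split; first by exists 0, None.
  by have [N HN] := hB k x; exists N => _ [i Pi <-]; apply: HN.
have r_ge0 k x : 0 <= r k x.
  apply: sup_upper_bound; last by exists None.
  split; first by exists 0, None.
  by have [N HN] := hB k x; exists N => _ [i Pi <-]; apply: HN.
have r_le k x v : 0 <= v -> (forall j, P k (Some j) -> h (Some j) x <= v) ->
    r k x <= v.
  move=> v0 hv; apply: ge_sup; first by exists 0, None.
  by move=> _ [[j|] Pj <-] //; apply: hv.
have rL k : real_lipschitz d (C + K) (r k).
  apply: sup_lipschitz; [|by exists None|exact: hB].
  move=> [j|] _ x y /=; last by rewrite subrr mulr_ge0 // addr_ge0.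
  rewrite -mulrBl ler_pdivrMr //.
  have gx1 : p j * (g1 x - g1 y) <= `|p j| * (C * d x y).
    apply: le_trans (ler_norm _) _; rewrite normrM ler_wpM2l //.
    exact: real_lipschitz_norm.
  have gx2 : q j * (g2 x - g2 y) <= `|q j| * (C * d x y).
    apply: le_trans (ler_norm _) _; rewrite normrM ler_wpM2l //.
    exact: real_lipschitz_norm.
  have bxy : b j y - b j x <= K * d x y by rewrite dC bL.
  have : K * d x y <= K * d x y * (`|p j| + `|q j|).
    by rewrite ler_peMr // mulr_ge0.
  by rewrite /e; lra.
pose f1 x := g1 x - \sum_k sgn_of k.1 * r k x.
pose f2 x := g2 x - \sum_k sgn_of k.2 * r k x.
have fL (s : bool * bool -> bool) (g : X -> R) : real_lipschitz d C g ->
    real_lipschitz d (5 * C + 4 * K) (fun x => g x - \sum_k sgn_of (s k) * r k x).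
  move=> gL x y.
  have : \sum_k sgn_of (s k) * r k y - \sum_k sgn_of (s k) * r k x
      <= \sum_(k : bool * bool) (C + K) * d x y.
    rewrite -sumrB; apply: ler_sum => k _; rewrite -mulrBr.
    apply: le_trans (ler_norm _) _; rewrite normrM sgn_of_abs mul1r distrC.
    exact: real_lipschitz_norm.
  rewrite sumr_const card_prod card_bool -mulr_natl.
  by have := gL x y; lra.
exists f1, f2; split; [exact: fL | exact: fL |] => x j.
have [t ht] := ex_t x; have [s hs] := ex_s x.
(* only the quadrant that contains (g1 x - s, g2 x - t) has violated normals *)
have r_eq0 k :
    ~ (0 < sgn_of k.1 * (g1 x - s) /\ 0 < sgn_of k.2 * (g2 x - t)) -> r k x = 0.
  move=> nk; apply/eqP; rewrite eq_le r_ge0 andbT; apply: r_le => // i [/= pi qi].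
  rewrite ler_pdivrMr // mul0r leNgt; apply/negP => ei; apply: nk.
  have := lt_le_trans ei (eS _ _ _ (hs i)); have := lt_le_trans ei (eT _ _ _ (ht i)).
  have sg (m : bool) (u v : R) : 0 < sgn_of m * u -> 0 < u * v -> 0 < sgn_of m * v.
    move=> mu uv; have u0 : u != 0.
      by apply: contraTneq uv => ->; rewrite mul0r ltxx.
    rewrite -(pmulr_rgt0 _ mu) mulrACA sgn_of_sqr mul1r //.
  by move=> hq hp; split; [apply: sg pi hp | apply: sg qi hq].
suff : e j x <= p j * (\sum_k sgn_of k.1 * r k x) + q j * (\sum_k sgn_of k.2 * r k x).
  by rewrite /e /f1 /f2; lra.
have [ac0|] := pselect (g1 x - s = 0 \/ g2 x - t = 0).
  have r0 k : r k x = 0.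
    by apply: r_eq0; case: ac0 => ->; rewrite mulr0 ltxx => -[].
  rewrite !big1 => [|k _|k _]; rewrite ?r0 ?mulr0 // addr0.
  case: ac0 => ac0; first by rewrite (le_trans (eS _ _ _ (hs j))) // ac0 mulr0.
  by rewrite (le_trans (eT _ _ _ (ht j))) // ac0 mulr0.
move=> /not_orP[/eqP a0 /eqP c0].
set a := g1 x - s in a0 r_eq0; set c := g2 x - t in c0 r_eq0.
pose k0 := (a < 0, c < 0).
have rk k : k != k0 -> r k x = 0.
  move=> kk0; apply: r_eq0 => -[/sgn_of_gt0 k1 /sgn_of_gt0 k2].
  by move/eqP: kk0; apply; rewrite /k0 -k1 -k2; case: (k).
have sumE (m : bool * bool -> bool) :
    \sum_k sgn_of (m k) * r k x = sgn_of (m k0) * r k0 x.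
  by rewrite (bigD1 k0) //= big1 ?addr0 // => k /rk ->; rewrite mulr0.
rewrite (sumE fst) (sumE snd) /=.
(* reflect the axes so that both shifts become positive *)
have S0 : 0 < `|a| by rewrite normr_gt0.
have T0 : 0 < `|c| by rewrite normr_gt0.
have hS i : e i x + - (sgn_of (a < 0) * p i) * `|a| <= 0.
  rewrite -(sgn_of_lt0 a a0) mulNr mulrACA sgn_of_sqr mul1r.
  by have := eS _ _ _ (hs i); rewrite -/a; lra.
have hT i : e i x + - (sgn_of (c < 0) * q i) * `|c| <= 0.
  rewrite -(sgn_of_lt0 c c0) mulNr mulrACA sgn_of_sqr mul1r.
  by have := eT _ _ _ (ht i); rewrite -/c; lra.
have normE i : - (sgn_of (a < 0) * p i) < 0 -> - (sgn_of (c < 0) * q i) < 0 ->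
    `|p i| + `|q i| = - - (sgn_of (a < 0) * p i) - - (sgn_of (c < 0) * q i).
  rewrite !oppr_lt0 !opprK => p0 q0.
  by rewrite -(gtr0_norm p0) -(gtr0_norm q0) !normrM !sgn_of_abs !mul1r.
have := diagonal_shift _ _ (e j x) _ _ (r k0 x) S0 T0 (r_ge0 k0 x) _ (hS j) (hT j).
have rST : r k0 x <= `|a| * `|c| / (`|a| + `|c|).
  apply: r_le => [|i [/= pi qi]]; first by rewrite divr_ge0 ?mulr_ge0 // addr_ge0.
  rewrite normE ?oppr_lt0 //; apply: excess_le_harmonic S0 T0 _ _ (hS i) (hT i);
    by rewrite oppr_lt0.
move=> /(_ rST) concl.
suff : e j x + (- (sgn_of (a < 0) * p j) + - (sgn_of (c < 0) * q j)) * r k0 x <= 0.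
  by lra.
apply: concl => p0 q0; rewrite -normE //; apply: r_ub.
by move: p0 q0; rewrite !oppr_lt0.
Qed.

(** * The finiteness principle *)

Lemma unit_dotp_le1 (u v : plane R) : dotp u u = 1 -> dotp v v = 1 -> `|dotp u v| <= 1.
Proof.
move=> u1 v1; rewrite ler_norml.
have := sqr_ge0 (u.1 - v.1); have := sqr_ge0 (u.2 - v.2).
have := sqr_ge0 (u.1 + v.1); have := sqr_ge0 (u.2 + v.2).
by move: u1 v1; rewrite /dotp !expr2 => *; apply/andP; split; lra.
Qed.

Lemma unit_coord_le1 (u : plane R) : dotp u u = 1 -> `|u.1| <= 1 /\ `|u.2| <= 1.
Proof.
have le1 (p q : R) : p * p + q * q = 1 -> `|p| <= 1.
  move=> pq; rewrite -(ler_pXn2r (n := 2)) ?nnegrE // real_normK ?num_real //.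
  by rewrite expr1n -pq -!expr2 lerDl sqr_ge0.
by rewrite /dotp => u1; split; [apply: le1 u1 | apply: (le1 _ u.1); rewrite addrC].
Qed.

(** Each half-plane is relaxed at [x] by [2 * C * d z x], which is what a
    [C]-Lipschitz pair satisfying the constraint of [z] at [z] can gain on the
    way to [x], both coordinates of the normal being at most [1]. The l1-norm
    of a unit normal is at least [1], so the correction has constant
    [5 * C + 4 * (2 * C)]. *)
Lemma finiteness_principle {X : Type} (d : X -> X -> R) (C : R)
    (H : X -> half_plane R) :
  real_pseudometric d -> 0 <= C ->
  all_bounded X \/
    spanning (fun x => (normal (H x)).1) (fun x => (normal (H x)).2) ->
  (forall k : bool -> bool -> X, exists u v : X -> R,
     [/\ real_lipschitz d C u, real_lipschitz d C v &
       forall s t, hp_set (H (k s t)) (u (k s t), v (k s t))]) ->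
  exists f1 f2 : X -> R, [/\ real_lipschitz d (13 * C) f1,
    real_lipschitz d (13 * C) f2 & forall x, hp_set (H x) (f1 x, f2 x)].
Proof.
move=> dP C0 tame four; have [d0 dxx dC dT] := dP.
pose p x := (normal (H x)).1; pose q x := (normal (H x)).2.
pose b x y := offset (H x) + 2 * C * d x y.
have unit x : p x ^+ 2 + q x ^+ 2 = 1.
  by have := normal_unit (H x); rewrite /dotp -!expr2.
have p1 x : `|p x| <= 1 by case: (unit_coord_le1 _ (normal_unit (H x))).
have q1 x : `|q x| <= 1 by case: (unit_coord_le1 _ (normal_unit (H x))).
have pq1 x : 1 <= `|p x| + `|q x|.
  have := unit x; rewrite -(real_normK (num_real (p x))).
  rewrite -(real_normK (num_real (q x))) !expr2.
  have := ler_piMr (normr_ge0 (p x)) (p1 x).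
  have := ler_piMr (normr_ge0 (q x)) (q1 x); lra.
have four' (k : bool -> bool -> X) : exists u v : X -> R,
     [/\ real_lipschitz d C u, real_lipschitz d C v &
       forall s t x, p (k s t) * u x + q (k s t) * v x <= b (k s t) x].
  have [u [v [uL vL uv]]] := four k; exists u, v; split=> // s t x.
  set z := k s t.
  have := uv s t; rewrite /hp_set /dotp /= -/z -/(p z) -/(q z) /b.
  have := real_lipschitz_mul d C u (p z) x z dP uL (p1 z).
  have := real_lipschitz_mul d C v (q z) x z dP vL (q1 z).
  rewrite (dC x z); lra.
have tame1 : (all_bounded X /\ all_bounded X) \/ spanning p q.
  by case: tame; [left | right].
have tame2 : (all_bounded X /\ all_bounded X) \/ spanning q p.
  case: tame1 => [|span]; [by left | right=> a c ac].
  have [|x hx] := span c a; first by case: ac; [right | left].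
  by exists x; lra.
have [g1 [g1L hg1]] : exists g, real_lipschitz d C g /\
    forall x, exists t, forall j, p j * g x + q j * t <= b j x.
  apply: coordinate_selection => // k; have [u [v [uL _ uv]]] := four' k.
  by exists u, v.
have [g2 [g2L hg2]] : exists g, real_lipschitz d C g /\
    forall x, exists t, forall j, q j * g x + p j * t <= b j x.
  apply: coordinate_selection => // k; have [u [v [_ vL uv]]] := four' k.
  by exists v, u; split=> // s t x; rewrite addrC.
have bL j : real_lipschitz d (2 * C) (b j).
  move=> x y; rewrite /b opprD addrACA subrr add0r -mulrBr ler_wpM2l ?mulr_ge0 //.
  by rewrite lerBlDr addrC (dC x y).
have [|f1 [f2 [f1L f2L ok]]] := correct_violations d C (2 * C) p q b g1 g2 dP C0
  (mulr_ge0 (ler0n _ 2) C0) pq1 bL g1L g2L hg1.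
  by move=> x; have [s hs] := hg2 x; exists s => j; rewrite addrC.
have <- : 5 * C + 4 * (2 * C) = 13 * C by ring.
exists f1, f2; split=> // x.
by have := ok x x; rewrite /b dxx mulr0 addr0.
Qed.

(** * Four half-planes *)

(** Each index bounds [b] by the affine function [h + s * a], from below or from
    above. Choosing [b] once [a] is known requires
    [(s i - s j) * a <= h j - h i] up to the distance, for [i] lower and [j] upper.
    For [s i <> s j] this bounds [a] by the abscissa
    [(h j - h i) / (s i - s j)] of the crossing point of the two lines, from the
    side given by the sign of [s i - s j]; for parallel lines it has to hold by
    itself. The crossing hypothesis says that these bounds on [a] are
    compatible. *)
Lemma select_between_lines {X I : Type} (d : X -> X -> R) (K B : R)
    (x : I -> X) (lower : I -> bool) (s h : I -> R) :
  real_pseudometric d -> 0 <= K -> 0 <= B -> all_bounded I ->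
  (forall i, `|s i| <= B) ->
  (forall i j, lower i -> ~~ lower j -> s i = s j ->
     h i - h j <= K * d (x i) (x j)) ->
  (forall i j k l, lower i -> ~~ lower j -> lower k -> ~~ lower l ->
     s j < s i -> s k < s l ->
     (h k - h l) / (s l - s k) <= (h j - h i) / (s i - s j)
       + K * (d (x i) (x j) / (s i - s j) + d (x k) (x l) / (s l - s k)
              + d (x i) (x k))) ->
  exists a b : X -> R,
    [/\ real_lipschitz d K a, real_lipschitz d ((1 + B) * K) b &
      forall i, if lower i then h i + s i * a (x i) <= b (x i)
                else b (x i) <= h i + s i * a (x i)].
Proof.
move=> dP K0 B0 bI sB parallel crossing; have [d0 dxx dC dT] := dP.
(* the relaxed bound on a at x i coming from the lines i and j *)
pose u i j := (h j - h i + K * d (x i) (x j)) / (s i - s j).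
have [a [aL aLU]] : exists a, real_lipschitz d K a /\ forall i j,
    lower i -> ~~ lower j -> (s i < s j -> u i j <= a (x i)) /\
                             (s j < s i -> a (x i) <= u i j).
  case: (lipschitz_between d K
    (fun y => [set v | exists i j,
       [/\ x i = y, lower i, ~~ lower j, s i < s j & v = u i j]])
    (fun y => [set v | exists i j,
       [/\ x i = y, lower i, ~~ lower j, s j < s i & v = u i j]])
    dP K0).
  - move=> _ _ _ _ [k [l [<- lk ll skl ->]]] [i [j [<- li lj sij ->]]].
    have := crossing i j k l li lj lk ll sij skl.
    have -> : u k l = (h k - h l) / (s l - s k) - K * d (x k) (x l) / (s l - s k).
      by rewrite /u; field; rewrite !subr_eq0 (lt_eqF skl) (gt_eqF skl).
    by rewrite /u (dC (x k) (x i)) (mulrDl (h j - h i)); lra.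
  - right; have [N HN] := all_bounded_prod bI bI (fun t => u t.1 t.2).
    by exists N => y v [] [i [j [_ _ _ _ ->]]]; apply: (HN (i, j)).
  move=> a [aL aLU]; exists a; split=> // i j li lj; have [aLo aUp] := aLU (x i).
  by split=> sij; [apply: aLo | apply: aUp]; exists i, j.
have slope i j : lower i -> ~~ lower j ->
    (s i - s j) * a (x i) <= h j - h i + K * d (x i) (x j).
  move=> li lj; have [lt_a gt_a] := aLU i j li lj.
  have [sij|sji|sij] := ltgtP (s i) (s j).
  - by rewrite mulrC -ler_ndivrMr ?subr_lt0 //; apply: lt_a.
  - by rewrite mulrC -ler_pdivlMr ?subr_gt0 //; apply: gt_a.
  - by have := parallel i j li lj sij; rewrite sij subrr mul0r; lra.
case: (lipschitz_between d ((1 + B) * K)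
    (fun y => [set v | exists i, [/\ x i = y, lower i & v = h i + s i * a y]])
    (fun y => [set v | exists i, [/\ x i = y, ~~ lower i & v = h i + s i * a y]])
    dP).
- by rewrite mulr_ge0 // addr_ge0.
- move=> _ _ _ _ [i [<- li ->]] [j [<- lj ->]].
  have : s j * (a (x i) - a (x j)) <= B * (K * d (x i) (x j)).
    apply: le_trans (ler_norm _) _; rewrite normrM ler_pM //.
    exact: real_lipschitz_norm.
  by have := slope i j li lj; lra.
- right; have [N HN] := bI (fun i => h i + s i * a (x i)).
  by exists N => y v [] [i [<- _ ->]].
move=> b [bL bLU]; exists a, b; split=> // i; have [bLo bUp] := bLU (x i).
by case: ifPn => li; [apply: bLo | apply: bUp]; exists i.
Qed.

(** The determinant of [u] and [v], hence up to sign the sine of their angle for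
    unit vectors. *)
Definition cross (u v : plane R) : R := u.1 * v.2 - u.2 * v.1.

(** A unit vector cannot be nearly orthogonal to two of the five directions below,
    the determinant of any two of which is at least [7 / 25] in absolute value.
    So four unit vectors exclude at most four of the five. *)
Lemma exists_transversal (n : bool * bool -> plane R) :
  (forall i, dotp (n i) (n i) = 1) ->
  exists e, dotp e e = 1 /\ forall i, 12^-1 <= `|dotp (n i) e|.
Proof.
move=> n1; apply: contrapT => none.
pose e (k : 'I_5) : plane R := nth (0, 1)
  [:: (1, 0); (0, 1); (3 / 5, 4 / 5); (4 / 5, 3 / 5); (- (3 / 5), 4 / 5)] k.
have /choice[f hf] : forall k, exists i, `|dotp (n i) (e k)| < 12^-1.
  move=> k; apply: contrapT => nk; apply: none; exists (e k); split.
    by case: k {nk} => -[|[|[|[|[|//]]]]] lt5; rewrite /e /dotp /=; lra.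
  by move=> i; rewrite leNgt; apply/negP => lti; apply: nk; exists i.
have : (#|'I_5| <= #|{: bool * bool}|)%N; last by rewrite card_ord card_prod card_bool.
apply: (leq_card f) => k l fkl; apply/eqP/negPn/negP => kl.
have nk := hf k; have nl := hf l; rewrite -fkl in nl.
have := n1 (f k); move: nk nl.
case: (n (f k)) => p q; rewrite /dotp !ltr_norml /= => /andP[k1 k2] /andP[l1 l2].
have [p_lo p_hi q_lo q_hi] : [/\ 0 <= 1 / 2 + p, 0 <= 1 / 2 - p,
    0 <= 1 / 2 + q & 0 <= 1 / 2 - q].
  move: k1 k2 l1 l2; case: k kl {fkl} => -[|[|[|[|[|//]]]]] lt5;
  case: l => -[|[|[|[|[|//]]]]] lt5' //= _; rewrite /e /= => *; split; lra.
by have := mulr_ge0 p_lo p_hi; have := mulr_ge0 q_lo q_hi; lra.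
Qed.

(** In the orthonormal frame [(e.2, - e.1)], [e] a half-plane whose boundary is not
    parallel to [e] lies below or above a graph. *)
Lemma frame_half_plane (n e P : plane R) (c : R) : dotp e e = 1 -> dotp n e != 0 ->
  let a := dotp (e.2, - e.1) P in let b := dotp e P in
  let s := - (dotp n (e.2, - e.1) / dotp n e) in
  dotp n P <= c <->
  if dotp n e < 0 then c / dotp n e + s * a <= b else b <= c / dotp n e + s * a.
Proof.
move=> e1 mu0 a b s.
have nP : dotp n P = dotp n (e.2, - e.1) * a + dotp n e * b.
  transitivity (dotp e e * dotp n P); first by rewrite e1 mul1r.
  by rewrite /a /b /dotp /=; ring.
have sE : c / dotp n e + s * a = (c - dotp n (e.2, - e.1) * a) / dotp n e.
  by rewrite /s; ring.
rewrite sE; case: ifPn => [mu|]; first by rewrite ler_ndivrMr // nP; split; lra.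
rewrite -leNgt le_eqVlt eq_sym (negPf mu0) /= => mu.
by rewrite ler_pdivlMr // nP; split; lra.
Qed.

Lemma frame_cross (n n' e : plane R) : dotp e e = 1 ->
  dotp n e != 0 -> dotp n' e != 0 ->
  cross n n' = dotp n e * dotp n' e *
    (- (dotp n' (e.2, - e.1) / dotp n' e) - - (dotp n (e.2, - e.1) / dotp n e)).
Proof.
move=> e1 mu0 mu0'; transitivity (dotp e e * cross n n'); first by rewrite e1 mul1r.
transitivity (dotp n (e.2, - e.1) * dotp n' e - dotp n' (e.2, - e.1) * dotp n e).
  by rewrite /dotp /cross /=; ring.
by field; apply/andP.
Qed.

Lemma dotp_unit_le (e P Q : plane R) : dotp e e = 1 ->
  dotp e Q - dotp e P <= 2 * `|P - Q|.
Proof.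
move=> /unit_coord_le1[e1 e2].
have coord (r p q : R) : `|r| <= 1 -> `|p - q| <= `|P - Q| ->
    r * (q - p) <= `|P - Q|.
  move=> r1 pq; apply: le_trans (ler_norm _) _; rewrite normrM distrC.
  by have := ler_pM (normr_ge0 r) (normr_ge0 _) r1 pq; rewrite mul1r.
have := coord _ P.1 Q.1 e1; have := coord _ P.2 Q.2 e2.
have -> : `|P.1 - Q.1| <= `|P - Q| by rewrite prod_normE /= le_max lexx.
have -> : `|P.2 - Q.2| <= `|P - Q| by rewrite prod_normE /= le_max lexx orbT.
by rewrite /dotp => /(_ isT) + /(_ isT); lra.
Qed.

(** The distance criterion in a component, in terms of points: for pairs with
    crossing boundary lines, and for single half-planes. The latter case takes
    care of pairs of parallel lines, where a quotient by the sine says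
    nothing. The diameter of a quadruple is replaced by the length of the path
    [x', x, y, y'], and [eps] accounts for distances that are not attained. *)
Definition close_corners {X : Type} (d : X -> X -> R) (H : X -> half_plane R)
    (lam : R) : Prop :=
  (forall x y eps, 0 < eps -> exists P Q : plane R,
     [/\ hp_set (H x) P, hp_set (H y) Q & `|P - Q| <= lam * d x y + eps]) /\
  (forall x x' y y' eps, 0 < eps ->
     cross (normal (H x)) (normal (H x')) != 0 ->
     cross (normal (H y)) (normal (H y')) != 0 ->
     exists P Q : plane R,
     [/\ hp_set (H x) P /\ hp_set (H x') P, hp_set (H y) Q /\ hp_set (H y') Q &
       `|P - Q| <= lam * (d x x' / `|cross (normal (H x)) (normal (H x'))|
                        + d y y' / `|cross (normal (H y)) (normal (H y'))|
                        + (d x x' + d x y + d y y')) + eps]).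

(** With normals at least [12^-1] along [e] the slopes are at most [12], and the
    sine of an angle is at least [144^-1] times the difference of slopes, itself
    at most [24]. So the distance of two corners is at most
    [(144 + 24) * lam] times the quantity in [select_between_lines], and their
    first coordinates in the frame differ by at most twice as much; whence
    [14 * 24]. The last factor [14 = 1 + (1 + 12)] comes from rotating back. *)
Lemma four_point_selection {X : Type} (d : X -> X -> R) (H : X -> half_plane R)
    (lam : R) : real_pseudometric d -> 0 <= lam -> close_corners d H lam ->
  forall k : bool -> bool -> X, exists u v : X -> R,
    [/\ real_lipschitz d (14 * (14 * (24 * lam))) u,
      real_lipschitz d (14 * (14 * (24 * lam))) v &
      forall s t, hp_set (H (k s t)) (u (k s t), v (k s t))].
Proof.
move=> dP lam0 [points corners] k; have [d0 dxx dC dT] := dP.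
pose x (i : bool * bool) := k i.1 i.2.
pose n i := normal (H (x i)).
have n1 i : dotp (n i) (n i) = 1 by exact: normal_unit.
have [e [e1 mu_ge]] := exists_transversal n n1.
pose e' : plane R := (e.2, - e.1).
have e'1 : dotp e' e' = 1 by move: e1; rewrite /dotp /= => <-; ring.
have [ex1 ex2] := unit_coord_le1 e e1.
pose mu i := dotp (n i) e.
have mu0 i : mu i != 0.
  by rewrite -normr_gt0; apply: lt_le_trans (mu_ge i); rewrite invr_gt0.
pose s i := - (dotp (n i) e' / mu i).
pose h i := offset (H (x i)) / mu i.
pose lower i := mu i < 0.
have s12 i : `|s i| <= 12.
  rewrite normrN normrM normfV ler_pdivrMr ?normr_gt0 //.
  by have := unit_dotp_le1 _ _ (n1 i) e'1; have := mu_ge i; rewrite -/(mu i); lra.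
have onE i P : hp_set (H (x i)) P <-> if lower i
    then h i + s i * dotp e' P <= dotp e P else dotp e P <= h i + s i * dotp e' P.
  by exact: (frame_half_plane (n i) e P (offset (H (x i))) e1 (mu0 i)).
have crossE i j : `|cross (n i) (n j)| = `|mu i| * `|mu j| * `|s i - s j|.
  by rewrite (frame_cross _ _ _ e1 (mu0 i) (mu0 j)) !normrM distrC.
have dcross i j D : 0 <= D -> s i != s j ->
    D / `|cross (n i) (n j)| <= 144 * (D / `|s i - s j|).
  move=> D0 sij; rewrite crossE invfM mulrCA ler_wpM2r ?divr_ge0 // invfM.
  have inv12 m : `|mu m|^-1 <= 12.
    by rewrite -[leRHS]invrK lef_pV2 ?posrE ?invr_gt0 ?normr_gt0 //; apply: mu_ge.
  have -> : (144 : R) = 12 * 12 by ring.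
  by rewrite ler_pM ?invr_ge0.
have dslope i j D : 0 <= D -> s i != s j -> D <= 24 * (D / `|s i - s j|).
  move=> D0 sij; rewrite mulrA ler_pdivlMr ?normr_gt0 ?subr_eq0 //.
  rewrite mulrC ler_wpM2r //; apply: le_trans (ler_normB _ _) _.
  by have := s12 i; have := s12 j; lra.
case: (select_between_lines d (14 * (24 * lam)) 12 x lower s h dP).
- by do 2!apply: mulr_ge0 (ler0n _ _) _.
- exact: ler0n.
- exact: all_bounded_fin.
- exact: s12.
- move=> i j li lj sij; apply/ler_addgt0Pr => eps eps0.
  (* 26 = 2 * (1 + 12), for the change of b - s i * a from P to Q *)
  have [|P [Q [hP hQ PQ]]] := points (x i) (x j) (eps / 26); first by rewrite divr_gt0.
  move/onE: hP; rewrite li => hP; move/onE: hQ; rewrite (negPf lj) -sij => hQ.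
  have := dotp_unit_le e Q P e1; have dPQ := dotp_unit_le e' P Q e'1.
  have dQP := dotp_unit_le e' Q P e'1.
  have : s i * (dotp e' Q - dotp e' P) <= 12 * (2 * `|P - Q|).
    apply: le_trans (ler_norm _) _; rewrite normrM ler_pM // ler_norml dPQ andbT.
    by rewrite lerNl opprB distrC.
  by rewrite (distrC Q P); have := mulr_ge0 lam0 (d0 (x i) (x j)); lra.
- move=> i j m l li lj lm ll sij sml; apply/ler_addgt0Pr => eps eps0.
  have nij : s i != s j by rewrite gt_eqF.
  have nml : s m != s l by rewrite lt_eqF.
  have cij : cross (n i) (n j) != 0.
    by rewrite -normr_eq0 crossE !mulf_neq0 // ?normr_eq0 // subr_eq0.
  have cml : cross (n m) (n l) != 0.
    by rewrite -normr_eq0 crossE !mulf_neq0 // ?normr_eq0 // subr_eq0.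
  have [|P [Q [[Pi Pj] [Qm Ql] PQ]]] := corners (x i) (x j) (x m) (x l) (eps / 2) _ cij cml.
    by rewrite divr_gt0.
  move/onE: Pi; rewrite li => Pi; move/onE: Pj; rewrite (negPf lj) => Pj.
  move/onE: Qm; rewrite lm => Qm; move/onE: Ql; rewrite (negPf ll) => Ql.
  have aP : dotp e' P <= (h j - h i) / (s i - s j).
    by rewrite ler_pdivlMr ?subr_gt0 //; lra.
  have aQ : (h m - h l) / (s l - s m) <= dotp e' Q.
    by rewrite ler_pdivrMr ?subr_gt0 //; lra.
  have := dotp_unit_le e' P Q e'1.
  have := dcross i j _ (d0 (x i) (x j)) nij; have := dslope i j _ (d0 (x i) (x j)) nij.
  have := dcross m l _ (d0 (x m) (x l)) nml; have := dslope m l _ (d0 (x m) (x l)) nml.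
  rewrite (gtr0_norm (x := s i - s j)) ?subr_gt0 //.
  rewrite (ltr0_norm (x := s m - s l)) ?subr_lt0 // opprB.
  move: PQ; rewrite -/(n i) -/(n j) -/(n m) -/(n l).
  set A := d (x i) (x j) / (s i - s j); set B := d (x m) (x l) / (s l - s m).
  set A' := _ / `|cross (n i) _|; set B' := _ / `|cross (n m) _|.
  move=> PQ B1 B2 A1 A2 aPQ.
  have : lam * (A' + B' + (d (x i) (x j) + d (x i) (x m) + d (x m) (x l)))
      <= lam * (168 * (A + B + d (x i) (x m))).
    by rewrite ler_wpM2l //; have := d0 (x i) (x m); lra.
  lra.
move=> a [b [aL bL ab]].
have comb (r t : R) : `|r| <= 1 -> `|t| <= 1 ->
    real_lipschitz d (14 * (14 * (24 * lam))) (fun y => r * a y + t * b y).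
  move=> r1 t1 y z.
  have := real_lipschitz_mul _ _ _ _ y z dP aL r1.
  by have := real_lipschitz_mul _ _ _ _ y z dP bL t1; lra.
exists (fun y => e.2 * a y + e.1 * b y), (fun y => - e.1 * a y + e.2 * b y).
split; [exact: comb | by apply: comb; rewrite ?normrN |] => s' t'.
have := ab (s', t'); set y := k s' t'; rewrite -[x _]/y => aby.
apply/(onE (s', t')).
have -> : dotp e' (e.2 * a y + e.1 * b y, - e.1 * a y + e.2 * b y) = a y.
  transitivity (dotp e e * a y); last by rewrite e1 mul1r.
  by rewrite /dotp /=; ring.
have -> // : dotp e (e.2 * a y + e.1 * b y, - e.1 * a y + e.2 * b y) = b y.
transitivity (dotp e e * b y); last by rewrite e1 mul1r.
by rewrite /dotp /=; ring.
Qed.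

Lemma half_planes_lipschitz_selection {X : Type} (d : X -> X -> R)
    (H : X -> half_plane R) (lam : R) :
  real_pseudometric d -> 0 <= lam -> close_corners d H lam ->
  all_bounded X \/
    spanning (fun x => (normal (H x)).1) (fun x => (normal (H x)).2) ->
  exists f : X -> plane R, (forall x, hp_set (H x) (f x)) /\
    forall x y, `|f x - f y| <= 13 * (14 * (14 * (24 * lam))) * d x y.
Proof.
move=> dP lam0 cc tame; have C0 : 0 <= 14 * (14 * (24 * lam)).
  by do 3!apply: mulr_ge0 (ler0n _ _) _.
have [f1 [f2 [f1L f2L fH]]] := finiteness_principle d (14 * (14 * (24 * lam))) H dP
  C0 tame (four_point_selection d H lam dP lam0 cc).
exists (fun x => (f1 x, f2 x)); split=> // x y.
have abs (f : X -> R) : real_lipschitz d (13 * (14 * (14 * (24 * lam)))) f ->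
    `|f x - f y| <= 13 * (14 * (14 * (24 * lam))) * d x y.
  by move=> fL; apply: real_lipschitz_norm.
by rewrite prod_normE ge_max /= !abs.
Qed.

(** * Corners and angles *)

Lemma hp_set_neq0 (H : half_plane R) : hp_set H !=set0.
Proof.
exists (offset H * (normal H).1, offset H * (normal H).2); rewrite /hp_set /=.
rewrite le_eqVlt; apply/orP; left; apply/eqP.
transitivity (offset H * dotp (normal H) (normal H)).
  by rewrite /dotp /=; ring.
by rewrite normal_unit mulr1.
Qed.

Lemma crossing_half_planes_neq0 (H K : half_plane R) :
  cross (normal H) (normal K) != 0 -> hp_set H `&` hp_set K !=set0.
Proof.
set n := normal H; set m := normal K => c0.
exists ((offset H * m.2 - offset K * n.2) / cross n m,
        (offset K * n.1 - offset H * m.1) / cross n m).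
have cE : cross n m = n.1 * m.2 - n.2 * m.1 by [].
split; rewrite /hp_set /dotp /= -/n -/m.
  suff -> : n.1 * ((offset H * m.2 - offset K * n.2) / cross n m) +
    n.2 * ((offset K * n.1 - offset H * m.1) / cross n m) = offset H by [].
  by rewrite [LHS](_ : _ = offset H * (n.1 * m.2 - n.2 * m.1) / cross n m);
    [rewrite -cE mulfK | ring].
suff -> : m.1 * ((offset H * m.2 - offset K * n.2) / cross n m) +
  m.2 * ((offset K * n.1 - offset H * m.1) / cross n m) = offset K by [].
by rewrite [LHS](_ : _ = offset K * (n.1 * m.2 - n.2 * m.1) / cross n m);
  [rewrite -cE mulfK | ring].
Qed.

Lemma sin_angle (H K : half_plane R) :
  sin (angle H K) = `|cross (normal H) (normal K)|.
Proof.
have dE : dotp (line_dir H) (line_dir K) = dotp (normal H) (normal K).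
  by rewrite /dotp /line_dir /=; ring.
have le1 := unit_dotp_le1 _ _ (normal_unit H) (normal_unit K).
rewrite /angle dE sin_acos; last by rewrite le1 andbT (le_trans _ (normr_ge0 _)) ?lerN10.
rewrite real_normK ?num_real // -sqrtr_sqr; congr Num.sqrt.
transitivity (dotp (normal H) (normal H) * dotp (normal K) (normal K)
  - dotp (normal H) (normal K) ^+ 2); first by rewrite !normal_unit mulr1.
by rewrite /dotp /cross; ring.
Qed.

(** Slide from [u] along the boundary direction of [H]. The excess of [u] over [K]
    is at most [sqrt 2] times the uniform distance to [v], by the l1-norm of a
    unit vector, and unit speed along the boundary decreases it at a rate equal to
    the absolute value of the determinant. *)
Lemma near_corner (H K : half_plane R) (u v : plane R) :
  hp_set H u -> hp_set K v -> cross (normal H) (normal K) != 0 ->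
  exists P, (hp_set H `&` hp_set K) P /\
    `|u - P| <= Num.sqrt 2 * `|u - v| / `|cross (normal H) (normal K)|.
Proof.
move=> Hu Kv c0; have cn0 : 0 < `|cross (normal H) (normal K)| by rewrite normr_gt0.
have bound0 : 0 <= Num.sqrt 2 * `|u - v| / `|cross (normal H) (normal K)|.
  by rewrite divr_ge0 // mulr_ge0 // sqrtr_ge0.
have [Ku|Ku] := pselect (hp_set K u).
  by exists u; rewrite subrr normr0.
move: Hu Kv Ku; rewrite /hp_set /= => Hu Kv /negP; rewrite -ltNge => Ku.
set n := normal H in c0 cn0 bound0 Hu *; set m := normal K in c0 cn0 bound0 Kv Ku *.
pose tau := (dotp m u - offset K) / cross n m.
have nn : dotp n n = 1 by exact: normal_unit.
have mm : dotp m m = 1 by exact: normal_unit.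
have cE : cross n m = n.1 * m.2 - n.2 * m.1 by [].
exists (u.1 + tau * n.2, u.2 - tau * n.1); split.
  split; rewrite /hp_set /= -/n -/m.
    by move: Hu; rewrite /dotp /=; lra.
  suff -> : dotp m (u.1 + tau * n.2, u.2 - tau * n.1) =
      dotp m u - (dotp m u - offset K) / cross n m * cross n m.
    by rewrite divfK //; lra.
  by rewrite -/tau cE /dotp /=; ring.
have mu : `|m.1| + `|m.2| <= Num.sqrt 2.
  rewrite -[leLHS]ger0_norm ?addr_ge0 // -sqrtr_sqr ler_sqrt // sqrrD.
  have := sqr_ge0 (`|m.1| - `|m.2|); rewrite sqrrB !real_normK ?num_real //.
  by move: mm; rewrite /dotp -!expr2; lra.
have tau_le : `|tau| <= Num.sqrt 2 * `|u - v| / `|cross n m|.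
  rewrite normrM normfV ler_pM2r ?invr_gt0 //.
  rewrite gtr0_norm ?subr_gt0 //.
  have le1 : m.1 * (u.1 - v.1) <= `|m.1| * `|u - v|.
    apply: le_trans (ler_norm _) _; rewrite normrM ler_wpM2l //.
    by rewrite prod_normE /= le_max lexx.
  have le2 : m.2 * (u.2 - v.2) <= `|m.2| * `|u - v|.
    apply: le_trans (ler_norm _) _; rewrite normrM ler_wpM2l //.
    by rewrite prod_normE /= le_max lexx orbT.
  have := ler_wpM2r (normr_ge0 (u - v)) mu.
  by move: Kv; rewrite /dotp; lra.
have [n1 n2] := unit_coord_le1 n nn.
have -> : u - (u.1 + tau * n.2, u.2 - tau * n.1) = (- (tau * n.2), tau * n.1).
  by case: (u) => u1 u2; congr pair => /=; ring.
rewrite prod_normE /= ge_max normrN; move: tau_le; clearbody tau => tau_le.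
by rewrite !normrM; apply/andP; split; apply: le_trans tau_le; rewrite ler_piMr.
Qed.

(** * Extended distances and components *)

Lemma dist_lt_close (A B : set (plane R)) (r eps : R) : A !=set0 -> B !=set0 ->
  (dist A B <= r%:E)%E -> 0 < eps ->
  exists P Q, [/\ A P, B Q & `|P - Q| <= r + eps].
Proof.
move=> [a Aa] [b Bb]; rewrite /dist; case: asboolP => [[A0|B0]|_].
- by move: Aa; rewrite A0.
- by move: Bb; rewrite B0.
move=> inf_le eps0; apply: contrapT => none.
have : ((r + eps)%:E <= ereal_inf [set (`|p - q|)%:E | p in A & q in B])%E.
  apply: le_ereal_inf_tmp => _ [p Ap [q Bq <-]]; rewrite lee_fin leNgt.
  by apply/negP => lt_pq; apply: none; exists p, q; split=> //; apply: ltW.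
by move=> /le_trans/(_ inf_le); rewrite lee_fin; lra.
Qed.

Lemma dist_le_norm (A B : set (plane R)) (P Q : plane R) : A P -> B Q ->
  (dist A B <= (`|P - Q|)%:E)%E.
Proof.
move=> AP BQ; rewrite /dist; case: asboolP => [_|_]; first by rewrite lee_fin.
by apply: ge_ereal_inf; exists (`|P - Q|)%:E => //; exists P => //; exists Q.
Qed.

Lemma scale_le_fin (lam T : R) (t : \bar R) : 0 <= lam -> (t <= T%:E)%E ->
  (scale lam t <= (lam * T)%:E)%E.
Proof.
move=> lam0 tT; rewrite /scale; case: eqP => [t_oo|_].
  by move: tT; rewrite t_oo leye_eq.
by rewrite EFinM lee_wpmul2l.
Qed.

Context {M : Type} (rho : M -> M -> \bar R) (F : M -> half_plane R)
  (rhoP : pseudometric rho).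

Definition in_component (z : M) := {x : M | component rho z x}.
Definition component_dist (z : M) (x y : in_component z) : R :=
  fine (rho (sval x) (sval y)).

Lemma component_distE (z : M) (x y : in_component z) :
  rho (sval x) (sval y) = (component_dist z x y)%:E.
Proof.
have [rho0 _ rhoC rhoT] := rhoP; rewrite fineK // ge0_fin_numE //.
apply: le_lt_trans (rhoT _ _ z) _; rewrite rhoC lte_add_pinfty //.
  exact: (svalP x).
exact: (svalP y).
Qed.

Lemma component_dist_pseudometric (z : M) : real_pseudometric (component_dist z).
Proof.
have [rho0 rhoxx rhoC rhoT] := rhoP; split=> [x y|x|x y|x y w].
- exact: fine_ge0.
- by rewrite /component_dist rhoxx.
- by rewrite /component_dist rhoC.
- by rewrite -lee_fin EFinD -!component_distE.
Qed.

Lemma diam_le (A : set M) (T : \bar R) :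
  (forall u v, A u -> A v -> (rho u v <= T)%E) -> (diam rho A <= T)%E.
Proof. by move=> AT; apply: ge_ereal_sup => _ [u Au [v Av <-]]; apply: AT. Qed.

Lemma diam_ge (A : set M) u v : A u -> A v -> (rho u v <= diam rho A)%E.
Proof.
by move=> Au Av; apply: ereal_sup_ubound; exists u => //; exists v.
Qed.

(** For single half-planes the criterion is applied to [x, x, y, y], where the two
    quotients are [0 / 0 = 0]. *)
Lemma dist_bound_close_corners (lam : R) (z : M) : dist_bound rho F lam ->
  close_corners (component_dist z) (fun x => F (sval x)) lam.
Proof.
move=> [lam0 db]; have [rho0 rhoxx rhoC rhoT] := rhoP.
have [d0 dxx dC dT] := component_dist_pseudometric z.
split=> [x y eps eps0|x x' y y' eps eps0 cx cy].
  have bnd : (frakD rho F (sval x) (sval x) (sval y) (sval y)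
      <= (component_dist z x y)%:E)%E.
    rewrite /frakD !rhoxx !mul0e !add0e; apply: diam_le => u v.
    have xy := component_distE z x y; rewrite -xy.
    by move=> [[[->|->]|->]|->] [[[->|->]|->]|->]; rewrite ?rhoxx // rhoC.
  have := le_trans (db _ _ _ _) (scale_le_fin _ _ _ lam0 bnd).
  rewrite !setIid => /dist_lt_close; apply => //; exact: hp_set_neq0.
have bnd : (frakD rho F (sval x) (sval x') (sval y) (sval y') <=
   (component_dist z x x' / `|cross (normal (F (sval x))) (normal (F (sval x')))|
  + component_dist z y y' / `|cross (normal (F (sval y))) (normal (F (sval y')))|
  + (component_dist z x x' + component_dist z x y + component_dist z y y'))%:E)%E.
  rewrite /frakD !sin_angle !inver !normr_eq0 (negPf cx) (negPf cy).
  rewrite !component_distE -!EFinM EFinD leeD2l //; apply: diam_le => u v.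
  have nn := d0; have := nn x x'; have := nn x y; have := nn y y'.
  have := dT x y y'; have := dT x' x y; have := dT x' x y'.
  have := dC x' x; have := dC y x; have := dC y' x; have := dC y x'.
  have := dC y' x'; have := dC y' y; have := dxx x; have := dxx x'.
  have := dxx y; have := dxx y'; do 16!move=> ?.
  by move=> [[[->|->]|->]|->] [[[->|->]|->]|->]; rewrite component_distE lee_fin; lra.
have := le_trans (db _ _ _ _) (scale_le_fin _ _ _ lam0 bnd).
move=> /dist_lt_close H.
have [||P [Q [[P1 P2] [Q1 Q2] PQ]]] := H eps _ _ eps0.
- exact: crossing_half_planes_neq0.
- exact: crossing_half_planes_neq0.
by exists P, Q.
Qed.

Lemma component_bounded (z : M) : finite_set (component rho z) ->
  all_bounded (in_component z).
Proof.
move=> fin phi.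
pose psi x := if pselect (component rho z x) is left h then phi (exist _ x h) else 0.
have [s sE] : exists s : seq R, psi @` component rho z = [set` s].
  by apply/finite_seqP; apply: finite_image.
exists (\sum_(r <- s) `|r|) => t.
have phit : phi t \in s.
  suff : [set` s] (phi t) by [].
  rewrite -sE; exists (sval t); first exact: (svalP t).
  rewrite /psi; case: pselect => [h|]; last by move/(_ (svalP t)).
  by case: t h => x h h' /=; rewrite (Prop_irrelevance h h').
by rewrite (big_rem _ phit) /= lerDl sumr_ge0.
Qed.

(** A small multiple of [(a, b)] is a convex combination of the normals, and it has
    positive scalar product with [(a, b)]. *)
Lemma component_spanning (z : M) : general_position F (component rho z) ->
  spanning (fun x : in_component z => (normal (F (sval x))).1)
           (fun x => (normal (F (sval x))).2).
Proof.
move=> [m [x [xS hull0]]] a b ab; apply: contrapT => none.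
pose v : plane R := (a, b).
have nonpos i : dotp (normal (F (x i))) v <= 0.
  rewrite leNgt; apply/negP => gt0; apply: none.
  by exists (exist _ (x i) (xS i)).
have /nbhs_ballP[e /= e0 ballH] := hull0.
have N0 : 0 < `|a| + `|b|.
  by case: ab => h; [rewrite ltr_wpDr // normr_gt0 | rewrite ltr_wpDl // normr_gt0].
pose c := e / (2 * (`|a| + `|b|)).
have c0 : 0 < c by rewrite divr_gt0 // mulr_gt0.
have small r : `|r| <= `|a| + `|b| -> `|0 - c * r| < e.
  move=> rN; rewrite sub0r normrN normrM gtr0_norm //.
  apply: (@le_lt_trans _ _ (c * (`|a| + `|b|))); first by rewrite ler_wpM2l // ltW.
  have -> : c * (`|a| + `|b|) = e / 2 by rewrite /c; field; rewrite gt_eqF.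
  lra.
have [t [t0 t1 cv]] : conv_hull (fun i => normal (F (x i))) (c * a, c * b).
  apply: ballH; split; rewrite /ball /= /ball_; apply: small.
    by rewrite lerDl.
  by rewrite lerDr.
have dotpZ (r : R) (n : plane R) : dotp (r *: n) v = r * dotp n v.
  by rewrite /dotp mulrDr !mulrA.
have : dotp (c * a, c * b) v <= 0.
  rewrite cv (big_morph (fun u => dotp u v) (id1 := 0) (op1 := +%R)).
  - by apply: sumr_le0 => i _; rewrite dotpZ mulr_ge0_le0.
  - by move=> u w; rewrite /dotp /=; ring.
  - by rewrite /dotp /= !mul0r addr0.
clearbody c; rewrite /dotp /= -!mulrA -mulrDr (pmulr_rle0 _ c0) leNgt => /negP; apply.
rewrite -!expr2; case: ab => h.
  by apply: ltr_wpDr; rewrite ?sqr_ge0 // lt0r sqrf_eq0 h sqr_ge0.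
by apply: ltr_wpDl; rewrite ?sqr_ge0 // lt0r sqrf_eq0 h sqr_ge0.
Qed.

(** The factor from the finiteness principle times that from four points. *)
Definition selection_constant : R := 13 * (14 * (14 * 24)).

Lemma selection_constant_gt0 : 0 < selection_constant.
Proof. by rewrite !mulr_gt0. Qed.

Lemma component_eq (x y : M) : (rho x y < +oo)%E -> component rho x = component rho y.
Proof.
have [rho0 rhoxx rhoC rhoT] := rhoP => xy; apply/seteqP; split=> w /= h.
  by apply: le_lt_trans (rhoT _ _ x) _; rewrite lte_add_pinfty // rhoC.
by apply: le_lt_trans (rhoT _ _ y) _; rewrite lte_add_pinfty.
Qed.

(** Selections on different components can be combined freely. They are chosen as a
    function of the component as a set, so that points of the same component
    use the same selection. *)
Lemma dist_bound_selection (lam : R) : finite_or_gp_components rho F ->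
  dist_bound rho F lam ->
  exists f, lip_bound rho f (selection_constant * lam) /\ selection F f.
Proof.
have [rho0 rhoxx rhoC rhoT] := rhoP => tame db; have [lam0 _] := db.
pose good (S : set M) (g : M -> plane R) := forall z, S = component rho z ->
  (forall x, S x -> hp_set (F x) (g x)) /\
  (forall x y, S x -> S y ->
     ((`|g x - g y|)%:E <= (selection_constant * lam)%:E * rho x y)%E).
have /choice[phi phiP] : forall S, exists g, good S g.
  move=> S; have [[z ->]|noz] := pselect (exists z, S = component rho z); last first.
    by exists (fun=> 0) => z Sz; case: noz; exists z.
  have cc := dist_bound_close_corners lam z db.
  have [|f [fF fL]] := half_planes_lipschitz_selection _ _ lam
    (component_dist_pseudometric z) lam0 cc.
    have [h|h] := tame z; first by left; apply: component_bounded h.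
    by right; apply: component_spanning h.
  pose g x := if pselect (component rho z x) is left h then f (exist _ x h) else 0.
  have gE (x : in_component z) : g (sval x) = f x.
    rewrite /g; case: pselect => [h|]; last by move/(_ (svalP x)).
    by case: x h => x h h' /=; rewrite (Prop_irrelevance h h').
  exists g => w _; split=> [x zx|x y zx zy].
    by have := fF (exist _ x zx); rewrite -gE.
  have := fL (exist _ x zx) (exist _ y zy); rewrite -!gE /=.
  have -> : 13 * (14 * (14 * (24 * lam))) = selection_constant * lam.
    by rewrite /selection_constant; ring.
  have -> : rho x y = (component_dist z (exist _ x zx) (exist _ y zy))%:E.
    by rewrite -component_distE.
  by rewrite -EFinM lee_fin.
have self x : component rho x x by rewrite /component /= rhoxx.
exists (fun x => phi (component rho x) x); split; last first.
  by move=> x; apply: (phiP (component rho x) x erefl).1.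
split; first by rewrite mulr_ge0 // ltW // selection_constant_gt0.
move=> x y; rewrite /scale; case: eqP => [_|/eqP xy]; first exact: leey.
have {}xy : (rho x y < +oo)%E by rewrite lt_neqAle xy leey.
by rewrite -(component_eq _ _ xy); apply: (phiP (component rho x) x erefl).2.
Qed.

Lemma quotient_ge0 x x' : (0 <= rho x x' / (sin (angle (F x) (F x')))%:E)%E.
Proof.
have [rho0 _ _ _] := rhoP.
by rewrite mule_ge0 // inve_ge0 lee_fin sin_angle.
Qed.

(** A finite quotient by a zero sine forces [rho x x' = 0], hence [f x = f x'] is
    itself a common point. *)
Lemma near_common_point (f : M -> plane R) (L : R) x x' :
  lip_bound rho f L -> selection F f ->
  (rho x x' / (sin (angle (F x) (F x')))%:E < +oo)%E ->
  exists P, (hp_set (F x) `&` hp_set (F x')) P /\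
    ((`|f x - P|)%:E <= (Num.sqrt 2 * L)%:E * (rho x x' / (sin (angle (F x) (F x')))%:E))%E.
Proof.
have [rho0 rhoxx rhoC rhoT] := rhoP => -[L0 fL] fF.
have := fL x x'; have := rho0 x x'; rewrite sin_angle inver normr_eq0.
case: (rho x x') => [r| |] //; last first.
  by case: ifP => [_|c0] _ _; rewrite ?mulyy // gt0_mulye // lte_fin invr_gt0 normr_gt0 c0.
rewrite lee_fin /scale /= -EFinM lee_fin => r0 fr.
case: ifPn => [_|c0 _].
  have [r_eq0|rn0] := eqVneq r 0; last by rewrite gt0_muley // lte_fin lt0r rn0.
  rewrite r_eq0 mulr0 normr_le0 subr_eq0 in fr *.
  move=> _; exists (f x); rewrite subrr normr0 mul0e mule0; split=> //.
  split; first exact: fF.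
  by rewrite (eqP fr).
have [P [PF hP]] := near_corner _ _ _ _ (fF x) (fF x') c0.
exists P; split=> //; rewrite -!EFinM lee_fin; apply: le_trans hP _.
by rewrite -mulrA -[leRHS]mulrA ler_wpM2l ?sqrtr_ge0 // mulrA ler_wpM2r // invr_ge0.
Qed.

Lemma lipschitz_selection_dist_bound (f : M -> plane R) (L : R) :
  lip_bound rho f L -> selection F f -> dist_bound rho F (Num.sqrt 2 * L).
Proof.
have [rho0 rhoxx rhoC rhoT] := rhoP => fLb fF; have [L0 fL] := fLb.
have s0 : 0 <= Num.sqrt 2 * L by rewrite mulr_ge0 ?sqrtr_ge0.
split=> // x x' y y'; rewrite /scale; case: eqP => [_|/eqP Dfin]; first exact: leey.
have {Dfin} : (frakD rho F x x' y y' < +oo)%E by rewrite lt_neqAle Dfin leey.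
have q1 := quotient_ge0 x x'; have q2 := quotient_ge0 y y'.
have dm : (rho x y <= diam rho [set x; x'; y; y'])%E.
  by apply: diam_ge; [left; left; left | left; right].
have dm0 := le_trans (rho0 x y) dm.
rewrite /frakD; move=> Dfin.
have fin1 : (rho x x' / (sin (angle (F x) (F x')))%:E < +oo)%E.
  apply: le_lt_trans Dfin; rewrite -addeA leeDl // adde_ge0 //.
have fin2 : (rho y y' / (sin (angle (F y) (F y')))%:E < +oo)%E.
  by apply: le_lt_trans Dfin; rewrite addeAC leeDr // adde_ge0.
have fin3 : (rho x y < +oo)%E.
  by apply: le_lt_trans dm _; apply: le_lt_trans Dfin; rewrite leeDr // adde_ge0.
have [P [PF fP]] := near_common_point f L x x' fLb fF fin1.
have [Q [QF fQ]] := near_common_point f L y y' fLb fF fin2.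
apply: le_trans (dist_le_norm _ _ _ _ PF QF) _.
apply: (@le_trans _ _ ((`|f x - P|)%:E + (`|f y - Q|)%:E + (`|f x - f y|)%:E)%E).
  rewrite -!EFinD lee_fin.
  have -> : P - Q = (f x - f y) - (f x - P) + (f y - Q).
    by rewrite opprB (addrC (f x - f y)) !addrA !subrK.
  apply: le_trans (ler_normD _ _) _.
  by have := ler_normB (f x - f y) (f x - P); lra.
rewrite !ge0_muleDr ?adde_ge0 //; apply: leeD; first exact: leeD.
have := fL x y; rewrite /scale lt_eqF // => /le_trans; apply.
apply: lee_pmul => //; rewrite lee_fin ler_peMl //.
by rewrite -[leLHS]sqrtr1 ler_sqrt // ler1n.
Qed.

End HalfPlanes.

Theorem theorem1p6 (R : realType) :
  exists gamma : R, 0 < gamma /\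
    forall (M : Type) (rho : M -> M -> \bar R) (F : M -> half_plane R),
      pseudometric rho ->
      (finite_set [set: M] \/
       (general_position F [set: M] /\ finite_or_gp_components rho F)) ->
      ((exists f : M -> plane R, is_lipschitz rho f /\ selection F f) <->
       (exists lambda : R, dist_bound rho F lambda)) /\
      (((Num.sqrt 2)^-1%:E * inf_dist_bound rho F
          <= lip_selection_norm rho F)%E /\
       (lip_selection_norm rho F <= gamma%:E * inf_dist_bound rho F)%E).
Proof.
exists selection_constant; split=> [|M rho F rhoP fin_or_gp].
  exact: selection_constant_gt0.
have tame : finite_or_gp_components rho F.
  case: fin_or_gp => [finM z|[]//]; left.
  by apply: sub_finite_set finM.
have norm_le f L : lip_bound rho f L -> (lip_norm rho f <= L%:E)%E.
  by move=> fL; apply: ge_ereal_inf; exists L%:E => //; exists L.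
have lipschitz_bound f : is_lipschitz rho f -> exists L, lip_bound rho f L.
  move=> f_lip; apply: contrapT => none.
  have : (+oo <= lip_norm rho f)%E.
    by apply: le_ereal_inf_tmp => _ [L fL <-]; case: none; exists L.
  by rewrite leNgt; move/negP; apply.
have select lam : dist_bound rho F lam -> exists f,
    [/\ is_lipschitz rho f, selection F f &
      (lip_norm rho f <= (selection_constant * lam)%:E)%E].
  move=> db; have [f [fL fF]] := dist_bound_selection rho F rhoP lam tame db.
  have nf := norm_le f _ fL; exists f; split=> //.
  by apply: le_lt_trans nf _; exact: ltry.
split; [split | split].
- move=> [f [f_lip fF]]; have [L fL] := lipschitz_bound f f_lip; exists (Num.sqrt 2 * L).
  exact: lipschitz_selection_dist_bound fL fF.
- by move=> [lam db]; have [f [f_lip fF _]] := select lam db; exists f.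
- have sqrt2_gt0 : 0 < Num.sqrt 2 :> R by rewrite sqrtr_gt0.
  apply: le_ereal_inf_tmp => _ [f [_ fF] <-].
  apply: le_ereal_inf_tmp => _ [L fL <-].
  have -> : L%:E = ((Num.sqrt 2)^-1%:E * (Num.sqrt 2 * L)%:E)%E.
    by rewrite -EFinM mulKf // gt_eqF.
  apply: lee_wpmul2l; first by rewrite lee_fin invr_ge0 ltW.
  apply: ge_ereal_inf; exists (Num.sqrt 2 * L)%:E => //; exists (Num.sqrt 2 * L) => //.
  exact: lipschitz_selection_dist_bound fL fF.
- have c0 : 0 < selection_constant :> R by exact: selection_constant_gt0.
  have : ((selection_constant^-1)%:E * lip_selection_norm rho F <= inf_dist_bound rho F)%E.
    apply: le_ereal_inf_tmp => _ [lam db <-].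
    have -> : lam%:E = ((selection_constant^-1)%:E * (selection_constant * lam)%:E)%E.
      by rewrite -EFinM mulKf // gt_eqF.
    apply: lee_wpmul2l; first by rewrite lee_fin invr_ge0 ltW.
    have [f [f_lip fF fn]] := select lam db.
    by apply: le_trans fn; apply: ge_ereal_inf; exists (lip_norm rho f) => //; exists f.
  move/(lee_wpmul2l (x := selection_constant%:E)); rewrite lee_fin ltW // => /(_ isT).
  by rewrite muleA -EFinM mulfV ?mul1e // gt_eqF.
Qed.
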